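(* Let $R$ be a Noetherian ring and let $\mathcal{A}=\{I\in A(R)^* \mid I\subseteq \mathrm{Nil}(R)\}$. Then the following statements hold: (1) If $|\mathrm{Min}(R)|\geq 2$, then $\omega(\mathcal{EG}(R))=\chi(\mathcal{EG}(R))=|\mathrm{Min}(R)|+|\mathcal{A}|$. (2) If $|\mathrm{Min}(R)|=1$, then $|\mathcal{A}|\leq \omega(\mathcal{EG}(R))=\chi(\mathcal{EG}(R))\leq |\mathcal{A}|+1$.
   Context: All rings are commutative with identity. $A(R)$ is the set of ideals of $R$ with non-zero annihilator, and $A(R)^*=A(R)\setminus\{(0)\}$. $\mathrm{Min}(R)$ is the set of minimal prime ideals and $\mathrm{Nil}(R)$ the nilradical of $R$. A non-zero ideal $I$ of $R$ is essential, written $I\leq_e R$, if it has non-zero intersection with every non-zero ideal of $R$. The essential annihilating-ideal graph $\mathcal{EG}(R)$ is the simple graph with vertex set $A(R)^*$ in which two distinct vertices $I,J$ are adjacent if and only if $\mathrm{Ann}(IJ)\leq_e R$. $\omega(G)$ denotes the clique number (the number of vertices in a largest complete subgraph) and $\chi(G)$ the vertex chromatic number of $G$. Cardinalities and these invariants take values in $\mathbb{N}\cup\{\infty\}$, where $\infty$ is written for any infinite value. *)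

(* Defs.v *)
From HB Require Import structures.
From mathcomp Require Import all_boot all_order all_algebra.
From mathcomp Require Import finmap all_classical.

Set Implicit Arguments.
Unset Strict Implicit.
Unset Printing Implicit Defensive.

Import GRing.Theory.
Local Open Scope classical_set_scope.
Local Open Scope ring_scope.

Variant enat := Fin of nat | Infty.

Definition le_enat (x y : enat) : bool :=
  match x, y with
  | _, Infty => true
  | Infty, Fin _ => false
  | Fin m, Fin n => (m <= n)%N
  end.

Definition add_enat (x y : enat) : enat :=
  match x, y with
  | Fin m, Fin n => Fin (m + n)
  | _, _ => Infty
  end.

Declare Scope enat_scope.
Delimit Scope enat_scope with enat.
Bind Scope enat_scope with enat.
Notation "x <= y" := (le_enat x y) : enat_scope.
Notation "x + y" := (add_enat x y) : enat_scope.

(* Least element of a set of natural numbers; oo if the set is empty. *)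
Definition einf (S : set nat) : enat :=
  if pselect (exists n, `[< S n >]) is left exS then Fin (ex_minn exS)
  else Infty.

(* The least n bounding S from above; oo if S is unbounded or contains oo. *)
Definition esup (S : set enat) : enat :=
  einf [set n | forall x, S x -> (x <= Fin n)%enat].

Definition ecard (T : choiceType) (A : set T) : enat :=
  if pselect (finite_set A) then Fin #|` fset_set A|%fset else Infty.

(* Only the restriction of adj to the vertex set is relevant. *)
Record sgraph (T : choiceType) := SGraph {
  vertices : set T;
  adj : T -> T -> Prop;
  adj_sym : forall x y, adj x y -> adj y x;
  adj_irrefl : forall x, ~ adj x x
}.

Section Graph.
Variables (T : choiceType) (G : sgraph T).

Definition clique (C : set T) : Prop :=
  C `<=` vertices G /\ forall x y, C x -> C y -> x <> y -> adj G x y.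

Definition clique_number : enat := esup [set ecard C | C in clique].

(* The colours are 0, ..., k - 1; c is arbitrary outside the vertex set (a map
   T -> 'I_k would wrongly exclude k = 0 for the graph without vertices). *)
Definition colorable (k : nat) : Prop :=
  exists c : T -> nat,
    (forall x, vertices G x -> (c x < k)%N) /\
    (forall x y, vertices G x -> vertices G y -> adj G x y -> c x <> c y).

Definition chromatic_number : enat := einf colorable.

End Graph.

Section Ideals.
Variable R : comPzRingType.
Implicit Types I J P Q : set R.

Definition ideal I : Prop :=
  [/\ I 0,
      forall x y, I x -> I y -> I (x + y) &
      forall a x, I x -> I (a * x)].

Definition zero_ideal : set R := [set 0].

Definition noetherian : Prop :=
  forall I, ideal I ->
  exists (n : nat) (g : 'I_n -> R),
    I = [set x | exists a : 'I_n -> R, x = \sum_(i < n) a i * g i].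

Definition ideal_mul I J : set R :=
  [set x | exists (n : nat) (a b : 'I_n -> R),
    [/\ forall i, I (a i), forall i, J (b i) & x = \sum_(i < n) a i * b i]].

Definition Ann I : set R := [set r | forall x, I x -> r * x = 0].

Definition prime_ideal P : Prop :=
  [/\ ideal P, ~ P 1 & forall x y, P (x * y) -> P x \/ P y].

Definition Min : set (set R) :=
  [set P | prime_ideal P /\
           forall Q, prime_ideal Q -> Q `<=` P -> Q = P].

Definition nilradical : set R := [set x | exists n : nat, x ^+ n = 0].

Definition essential I : Prop :=
  [/\ ideal I, I <> zero_ideal &
      forall J, ideal J -> J <> zero_ideal -> I `&` J <> zero_ideal].

Definition annihilating_ideals : set (set R) :=
  [set I | ideal I /\ Ann I <> zero_ideal].

Definition annihilating_idealsS : set (set R) :=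
  annihilating_ideals `\ zero_ideal.

Definition nil_annihilating_idealsS : set (set R) :=
  [set I | annihilating_idealsS I /\ I `<=` nilradical].

Definition EG_adj I J : Prop := I <> J /\ essential (Ann (ideal_mul I J)).

Lemma ideal_mulC I J : ideal_mul I J = ideal_mul J I.
Proof.
by apply/seteqP; split => x [n [a [b [Ia Jb ->]]]]; exists n, b, a;
  split => //; apply: eq_bigr => i _; rewrite mulrC.
Qed.

Lemma EG_adj_sym I J : EG_adj I J -> EG_adj J I.
Proof.
by case=> IJ eIJ; split; [exact/nesym | rewrite ideal_mulC].
Qed.

Lemma EG_adj_irrefl I : ~ EG_adj I I.
Proof. by case. Qed.

Definition EG : sgraph (set R) :=
  SGraph annihilating_idealsS EG_adj_sym EG_adj_irrefl.

End Ideals.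

Arguments zero_ideal {R}.
Arguments noetherian R : clear implicits.
Arguments Min R : clear implicits.
Arguments nilradical R : clear implicits.
Arguments annihilating_ideals R : clear implicits.
Arguments annihilating_idealsS R : clear implicits.
Arguments nil_annihilating_idealsS R : clear implicits.
Arguments EG R : clear implicits.

(* Main.v *)
(** In a Noetherian ring, Ann(L) is essential if and only if L consists of
    nilpotent elements, so distinct I and J are adjacent exactly when every
    minimal prime contains I or J.  The nonzero nil ideals are therefore adjacent
    to all vertices, while two vertices avoiding a common minimal prime are not
    adjacent: the elements of A together with Min(R) suffice as colours.  If there
    are at least two minimal primes, the ideals obtained by intersecting all
    minimal primes but one form, together with A, a clique of that size; if there
    is only one, A can be enlarged by at most one vertex.  The facts needed
    on minimal primes (finiteness, intersection, nonzero annihilators) are read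
    off a product of primes that vanishes. *)

Require Import Defs.
From mathcomp Require Import all_boot all_order all_algebra.
From mathcomp Require Import finmap all_classical.

Set Implicit Arguments.
Unset Strict Implicit.
Unset Printing Implicit Defensive.

Import GRing.Theory.
Local Open Scope classical_set_scope.
Local Open Scope ring_scope.

(** * Cardinalities and infima with values in [enat] *)

Lemma ecard_finite (T : choiceType) (A : set T) :
  finite_set A -> ecard A = Fin #|` fset_set A|%fset.
Proof. by rewrite /ecard; case: pselect. Qed.

Lemma ecard_infinite (T : choiceType) (A : set T) :
  ~ finite_set A -> ecard A = Infty.
Proof. by rewrite /ecard; case: pselect. Qed.

Lemma ecard_subset (T : choiceType) (A B : set T) :
  A `<=` B -> (ecard A <= ecard B)%enat.
Proof.
move=> AB; case: (pselect (finite_set B)) => [fB|iB]; last first.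
  by rewrite (ecard_infinite iB); case: ecard.
have fA : finite_set A by exact: sub_finite_set fB.
rewrite !ecard_finite //=; apply/fsubset_leq_card/fsubsetP => x.
by rewrite !in_fset_set// !inE; apply: AB.
Qed.

Lemma ecard_set1 (T : choiceType) (x : T) : ecard [set x] = Fin 1.
Proof. by rewrite ecard_finite // fset_set1 cardfs1. Qed.

Lemma ecard_setU (T : choiceType) (A B : set T) :
  (forall x, A x -> ~ B x) -> ecard (A `|` B) = (ecard A + ecard B)%enat.
Proof.
move=> AB; case: (pselect (finite_set A)) => [fA|iA]; last first.
  by rewrite (ecard_infinite iA) ecard_infinite // finite_setU => -[].
case: (pselect (finite_set B)) => [fB|iB]; last first.
  rewrite (ecard_infinite iB) ecard_infinite; first by case: ecard.
  by rewrite finite_setU => -[].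
have fAB : finite_set (A `|` B) by rewrite finite_setU.
rewrite !ecard_finite //= fset_setU //; congr Fin; apply/eqP.
rewrite (leq_card_fsetU _ _).2; apply/fdisjointP => x.
rewrite !in_fset_set // !inE => Ax; apply/negP; rewrite inE; exact: AB.
Qed.

Lemma ecard_image_inj (T U : choiceType) (f : T -> U) (A : set T) :
  (forall x y, A x -> A y -> f x = f y -> x = y) ->
  ecard (f @` A) = ecard A.
Proof.
move=> finj.
have /inj_card_eq fA : {in A &, injective f}.
  by move=> x y; rewrite !inE; apply: finj.
have [fin|inf] := pselect (finite_set A).
  have fin' : finite_set (f @` A) by exact: finite_image.
  by rewrite !ecard_finite //; congr Fin; apply/fcard_eq.
rewrite !ecard_infinite // => fin'; apply: inf.
by rewrite -(eq_finite_set fA).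
Qed.

Lemma einf_min (S : set nat) n :
  S n -> (forall m, S m -> (n <= m)%N) -> einf S = Fin n.
Proof.
move=> Sn nmin; rewrite /einf; case: pselect => [exS|[]]; last first.
  by exists n; apply/asboolP.
case: ex_minnP => m /asboolP Sm mmin; congr Fin; apply/eqP.
by rewrite eqn_leq nmin // mmin //; apply/asboolP.
Qed.

Lemma einf_empty (S : set nat) : (forall n, ~ S n) -> einf S = Infty.
Proof.
by move=> S0; rewrite /einf; case: pselect => // exS; have [n /asboolP/S0] := exS.
Qed.

(** Serves to find minimal primes in a finite list of primes. When a head [Q0] is added, a minimal
    [P] already found below [Q] in the tail survives unless [Q0] lies below it. *)
Lemma seq_minimal_subset (T : Type) (s : seq (set T)) Q :
  Q \in s -> exists P, [/\ P \in s, P `<=` Q &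
    forall P', P' \in s -> P' `<=` P -> P' = P].
Proof.
elim: s Q => // Q0 s IHs Q; rewrite inE => Qs.
have [[P [Ps PQ Pmin]]|nP] := pselect (exists P, [/\ P \in s, P `<=` Q &
    forall P', P' \in s -> P' `<=` P -> P' = P]).
  have [Q0P|nQ0P] := pselect (Q0 `<=` P); last first.
    exists P; split=> // [|P']; rewrite inE ?Ps ?orbT // => /orP[/eqP->//|].
    exact: Pmin.
  exists Q0; split; rewrite ?mem_head //; first exact: subset_trans PQ.
  move=> P'; rewrite inE => /orP[/eqP//|P's P'Q0].
  apply/seteqP; split=> //.
  by rewrite (Pmin P' P's (subset_trans P'Q0 Q0P)).
have nsQ P : P \in s -> ~ (P `<=` Q).
  move=> Ps PQ; have [P' [P's P'P P'min]] := IHs P Ps.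
  by apply: nP; exists P'; split=> //; exact: subset_trans PQ.
have /negPf nQs : Q \notin s by apply/negP => /nsQ; exact.
move: Qs; rewrite nQs orbF => /eqP QQ0; exists Q; split; rewrite ?inE ?QQ0 ?eqxx //.
by move=> P'; rewrite inE => /orP[/eqP//|/nsQ]; rewrite QQ0.
Qed.

(** * Cliques against colourings *)

Section Cliques.
Variables (T : choiceType) (G : sgraph T).

(** A colouring is injective on a clique; as the colours are finitely many, infinite cliques are
    ruled out too. *)
Lemma colorable_clique k C :
  colorable G k -> clique G C -> (ecard C <= Fin k)%enat.
Proof.
move=> [c [ck cadj]] [CV Cadj].
have cinj x y : C x -> C y -> c x = c y -> x = y.
  move=> Cx Cy cxy; apply: contrapT => xy.
  by case: (cadj x y (CV _ Cx) (CV _ Cy) (Cadj _ _ Cx Cy xy)).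
rewrite -(ecard_image_inj cinj).
have cI : c @` C `<=` `I_k by move=> _ [x Cx <-]; exact/ck/CV.
have fin : finite_set (c @` C) by apply: sub_finite_set cI _; exact: finite_II.
rewrite ecard_finite //; apply: geq_card_fset_set; exact: subset_card_le.
Qed.

(** A clique and a colouring of the same size certify each other as optimal. *)
Lemma colorable_clique_eq k C :
  clique G C -> ecard C = Fin k -> colorable G k ->
  clique_number G = Fin k /\ chromatic_number G = Fin k.
Proof.
move=> cC Ck colk; split; apply: einf_min => //.
- by move=> _ [D cD <-]; exact: colorable_clique.
- by move=> m /(_ (Fin k)); apply; exists C.
- by move=> m colm; have := colorable_clique colm cC; rewrite Ck.
Qed.

Lemma clique_infinite C :
  clique G C -> ecard C = Infty ->
  clique_number G = Infty /\ chromatic_number G = Infty.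
Proof.
move=> cC Coo; split; apply: einf_empty => m.
- by move=> /(_ Infty) h; have : (Infty <= Fin m)%enat by apply: h; exists C.
- by move=> colm; have := colorable_clique colm cC; rewrite Coo.
Qed.

End Cliques.

(** * Ideals, primes and products of primes *)

Section Ideals.
Variable R : comPzRingType.
Implicit Types (I J L P Q : set R) (s : seq (set R)).

Lemma ideal_Ann L : ideal (Ann L).
Proof.
split=> [x _|x y Lx Ly z Lz|a x Lx z Lz]; first by rewrite mul0r.
- by rewrite mulrDl Lx // Ly // addr0.
- by rewrite -mulrA Lx // mulr0.
Qed.

Lemma ideal_neq0 I : ideal I -> I <> zero_ideal <-> exists2 x, I x & x <> 0.
Proof.
move=> [I0 _ _]; split=> [nI|[x Ix x0 IE]]; last by move: Ix; rewrite IE.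
apply: contrapT => nex; apply: nI; apply/seteqP; split=> x; last by move->.
by move=> Ix; apply: contrapT => x0; apply: nex; exists x.
Qed.

Lemma ideal_principal (a : R) : ideal [set x | exists r, x = r * a].
Proof.
split=> [|_ _ [r ->] [t ->]|b _ [r ->]]; first by exists 0; rewrite mul0r.
- by exists (r + t); rewrite mulrDl.
- by exists (b * r); rewrite mulrA.
Qed.

Lemma prime_one_neq0 P : prime_ideal P -> (1 : R) <> 0.
Proof. by move=> [[P0 _ _] P1 _] R10; apply: P1; rewrite R10. Qed.

Lemma prime_exp P x n : prime_ideal P -> P (x ^+ n) -> P x.
Proof.
move=> [_ P1 Pp]; elim: n => [|n IHn]; first by rewrite expr0.
by rewrite exprS => /Pp[].
Qed.

Lemma nilradical_sub_prime P : prime_ideal P -> nilradical R `<=` P.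
Proof.
by move=> Pp x [n xn]; apply: (@prime_exp P x n) => //; rewrite xn; case: Pp => -[].
Qed.

(** Single products only, without sums: inclusion of the product ideal in an ideal can be tested on
    them. *)
Fixpoint products s : set R :=
  if s is P :: s' then
    [set x | exists2 p, P p & exists2 z, products s' z & x = p * z]
  else [set 1].

Lemma products_cat s t :
  products (s ++ t) `<=`
  [set x | exists2 y, products s y & exists2 z, products t z & x = y * z].
Proof.
elim: s => [|P s IHs] x /=.
  by move=> tx; exists 1 => //; exists x; rewrite ?mul1r.
move=> [p Pp [_ /IHs[y sy [z tz ->]] ->]].
exists (p * y); first by exists p => //; exists y.
by exists z; rewrite ?mulrA.
Qed.

(** Otherwise elements outside [P], one from each factor, would multiply to an element outside
    [P]. *)
Lemma products_sub_prime P s :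
  prime_ideal P -> products s `<=` P -> exists2 Q, Q \in s & Q `<=` P.
Proof.
move=> [Pi P1 Pp]; elim: s => [|Q s IHs] sP; first by case: P1; apply: sP.
have [QP|/existsNP[q /not_implyP[Qq nPq]]] := pselect (Q `<=` P).
  by exists Q => //; rewrite mem_head.
have [|Q' Q's Q'P] := IHs; last by exists Q' => //; rewrite inE Q's orbT.
move=> z sz; have /Pp[] // : P (q * z) by apply: sP; exists q => //; exists z.
Qed.

(* Follow x, x l_1, x l_1 l_2, ... with l_i in L as long as it is nonzero; it
   vanishes after size s steps. *)
Lemma products_nilpotent L s (x : R) :
  x <> 0 -> (forall z, products s z -> x * z = 0) ->
  (forall Q, Q \in s -> L `<=` Q) ->
  exists r, r * x <> 0 /\ forall l, L l -> r * x * l = 0.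
Proof.
elim: s x => [|Q s IHs] x x0 sx LQ; first by case: x0; rewrite -[x]mulr1 sx.
have [xL|/existsNP[l /not_implyP[Ll xl]]] := pselect (forall l, L l -> x * l = 0).
  by exists 1; rewrite mul1r.
have [|z sz|Q' Q's|r [rx rL]] := IHs (x * l).
- by [].
- by rewrite -mulrA sx //; exists l; [apply: (LQ _ _ _ Ll); rewrite mem_head|exists z].
- by apply: LQ; rewrite inE Q's orbT.
by exists (r * l); rewrite -mulrA [l * x]mulrC.
Qed.

(* k is the product of one element outside P from each Q in s distinct from P;
   m is the multiplicity of P in s. *)
Lemma products_nseq_prime P s :
  prime_ideal P -> (forall Q, Q \in s -> ideal Q) ->
  (forall Q, Q \in s -> Q `<=` P -> Q = P) ->
  exists k m, [/\ ~ P k, forall Q, Q \in s -> Q <> P -> Q k &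
    forall z, products (nseq m P) z -> products s (k * z)].
Proof.
move=> [Pi P1 Pp]; elim: s => [|Q s IHs] si sP.
  by exists 1, 0%N; split => // z /= ->; rewrite mul1r.
have [Q' Q's|Q' Q's|k [m [nPk sk kz]]] := IHs.
- by apply: si; rewrite inE Q's orbT.
- by apply: sP; rewrite inE Q's orbT.
have [QP|/existsNP[q /not_implyP[Qq nPq]]] := pselect (Q `<=` P).
  have {QP}-> : Q = P by apply: sP => //; rewrite mem_head.
  exists k, m.+1; split => // [Q'|_ [p Pp' [z mz ->]]].
    by rewrite inE => /orP[/eqP->|/sk].
  by exists p => //; exists (k * z); [exact: kz|rewrite mulrCA].
have [_ _ QM] := si Q (mem_head _ _).
exists (q * k), m; split => [/Pp[]//|Q'|z mz].
- rewrite inE => /orP[/eqP->|Q's] nQ'; first by rewrite mulrC; exact: QM.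
  by have [|_ _] := si Q'; [rewrite inE Q's orbT|apply; exact: sk].
- by exists q => //; exists (k * z); [exact: kz|rewrite mulrA].
Qed.

(** * Chain conditions and products of primes in a Noetherian ring *)

Hypothesis noethR : noetherian R.

(** The union of the chain is finitely generated, and one stage contains all the generators. *)
Lemma noetherian_chain (I : nat -> set R) :
  (forall n, ideal (I n)) -> (forall n, I n `<=` I n.+1) ->
  exists N, forall n, I n `<=` I N.
Proof.
move=> Ii Imono.
have Ile m n : (m <= n)%N -> I m `<=` I n.
  move=> /subnK <-; elim: (n - m)%N => [|d IHd] // x /IHd; exact: Imono.
have Ui : ideal [set x | exists n, I n x].
  split=> [|x y [m Ix] [n Iy]|a x [n Ix]]; first by exists 0%N; have [] := Ii 0%N.
  - exists (maxn m n); have [_ ID _] := Ii (maxn m n); apply: ID.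
      by apply: Ile Ix; rewrite leq_maxl.
    by apply: Ile Iy; rewrite leq_maxr.
  - by exists n; have [_ _] := Ii n; apply.
have [n [g UE]] := noethR Ui.
have /choice[f fP] (i : 'I_n) : exists m, I m (g i).
  suff : [set x | exists m, I m x] (g i) by [].
  rewrite UE; exists (fun j => if j == i then 1 else 0).
  rewrite (bigD1 i) //= eqxx mul1r big1 ?addr0 // => j /negPf ->.
  by rewrite mul0r.
exists (\max_i f i)%N => m x Ix.
have : [set x | exists m, I m x] x by exists m.
rewrite UE => -[a ->]; have [I0 ID IM] := Ii (\max_i f i)%N.
by apply: big_ind => // i _; apply: IM; apply: Ile (fP i); exact: leq_bigmax.
Qed.

Lemma noetherian_maximal (F : set (set R)) I :
  (forall J, F J -> ideal J) -> F I ->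
  exists2 M, F M & forall J, F J -> M `<=` J -> J `<=` M.
Proof.
move=> Fi FI; apply: contrapT => nmax.
(* Without a maximal member, choice produces a strictly increasing sequence in [F]. *)
have /choice[f fP] (M : {J | F J}) : exists N : {J | F J},
    sval M `<=` sval N /\ ~ (sval N `<=` sval M).
  apply: contrapT => nN; case: M nN => M FM nN; apply: nmax; exists M => // J FJ MJ.
  by apply: contrapT => nJM; apply: nN; exists (exist _ J FJ).
pose c n := sval (iter n f (exist _ I FI)).
have [n|n|N /(_ N.+1)] := @noetherian_chain c.
- by apply: Fi; exact: svalP.
- by have [] := fP (iter n f (exist _ I FI)).
- by have [] := fP (iter N f (exist _ I FI)).
Qed.

(* Noetherian induction: an ideal maximal among those containing no product of
   primes would be prime. *)
Lemma noetherian_products I : ideal I ->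
  exists2 s, (forall Q, Q \in s -> prime_ideal Q) & products s `<=` I.
Proof.
move=> Ii; apply: contrapT => nI.
pose good J := exists2 s, (forall Q, Q \in s -> prime_ideal Q) & products s `<=` J.
have [|M [Mi nM] Mmax] :=
  @noetherian_maximal [set J | ideal J /\ ~ good J] I _ (conj Ii nI).
  by move=> J [].
have [M0 MD MM] := Mi.
(* The ideal generated by [M] and [a] is strictly larger than [M], hence good by maximality. *)
have ext a : ~ M a -> good [set z | exists2 m, M m & exists r, z = m + r * a].
  move=> nMa; apply: contrapT => nJ; apply: nMa.
  apply: (Mmax [set z | exists2 m, M m & exists r, z = m + r * a]).
  - split => //; split.
    + by exists 0 => //; exists 0; rewrite mul0r addr0.
    + move=> _ _ [m Mm [r ->]] [n Mn [t ->]]; exists (m + n); first exact: MD.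
      by exists (r + t); rewrite mulrDl addrACA.
    + move=> b _ [m Mm [r ->]]; exists (b * m); first exact: MM.
      by exists (b * r); rewrite mulrDr mulrA.
  - by move=> m Mm; exists m => //; exists 0; rewrite mul0r addr0.
  - by exists 0 => //; exists 1; rewrite mul1r add0r.
(* The unit ideal is not prime, but it contains the empty product. *)
apply: nM; have [M1|nM1] := pselect (M 1); first by exists [::] => // _ ->.
have [Mp|nMp] := pselect (forall x y, M (x * y) -> M x \/ M y).
  exists [:: M] => [Q|_ [m Mm [_ -> ->]]]; last by rewrite mulr1.
  by rewrite inE => /eqP->.
have /existsNP[x /existsNP[y /not_implyP[Mxy /not_orP[nMx nMy]]]] := nMp.
have [[s sp sJ] [t tp tJ]] := (ext x nMx, ext y nMy).
(* The product [(m + r * x) * (n + u * y)] lies in [M] because [x * y] does. *)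
exists (s ++ t) => [Q|_ /products_cat[_ /sJ[m Mm [r ->]] [_ /tJ[n Mn [u ->]] ->]]].
  by rewrite mem_cat => /orP[/sp|/tp].
rewrite mulrDl; apply: (MD); first by rewrite mulrC; exact: MM.
rewrite mulrDr; apply: (MD); first exact: MM.
by rewrite mulrACA; exact: MM.
Qed.

Lemma zero_products :
  exists2 s, (forall Q, Q \in s -> prime_ideal Q) & products s `<=` zero_ideal.
Proof.
apply: noetherian_products; split=> [//|_ _ -> ->|a _ ->]; first exact: addr0.
exact: mulr0.
Qed.

(** * Minimal primes *)

Lemma products_Min s P :
  (forall Q, Q \in s -> prime_ideal Q) -> products s `<=` zero_ideal ->
  Min R P -> P \in s.
Proof.
move=> sp s0 [Pp Pmin]; have [z /s0 ->|Q Qs QP] := @products_sub_prime P s Pp.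
  by case: Pp => -[].
by rewrite -(Pmin Q (sp _ Qs) QP).
Qed.

Lemma finite_Min : finite_set (Min R).
Proof.
have [s sp s0] := zero_products; apply: sub_finite_set (finite_seq s).
by move=> P MP /=; exact: products_Min s0 MP.
Qed.

(** Every prime contains a member of the list [s], so a minimal member of [s] is minimal among all
    primes. *)
Lemma Min_below Q : prime_ideal Q -> exists2 P, Min R P & P `<=` Q.
Proof.
move=> Qp; have [s sp s0] := zero_products.
have below P : prime_ideal P -> exists2 P', P' \in s & P' `<=` P.
  move=> Pp; apply: products_sub_prime => // z /s0 ->.
  by case: Pp => -[].
have [Q' Q's Q'Q] := below Q Qp.
have [P [Ps PQ' Pmin]] := seq_minimal_subset Q's.
exists P; last exact: subset_trans Q'Q.
split=> [|P' P'p P'P]; first exact: sp.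
have [P'' P''s P''P'] := below P' P'p.
by apply/seteqP; split=> //; rewrite -(Pmin P'' P''s) //; exact: subset_trans P'P.
Qed.

(** Conversely, an element of all minimal primes lies in every factor of the vanishing product, so
    its power [x ^+ size s] is zero. *)
Lemma nilradicalP x : nilradical R x <-> forall P, Min R P -> P x.
Proof.
split=> [nx P [Pp _]|xM]; first exact: nilradical_sub_prime nx.
have [s sp s0] := zero_products; exists (size s); apply: s0.
elim: s sp => [|Q s IHs] sp; first by rewrite /= expr0.
exists x; first by have [P MP] := Min_below (sp Q (mem_head _ _)); apply; exact: xM.
exists (x ^+ size s); last by rewrite exprS.
by apply: IHs => Q' Q's; apply: sp; rewrite inE Q's orbT.
Qed.

Lemma Min_avoid P : Min R P ->
  exists2 k, ~ P k & forall Q, Min R Q -> Q <> P -> Q k.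
Proof.
move=> MP; have [s sp s0] := zero_products.
have [Q /sp[]//|Q /sp Qp|k [m [nPk sk _]]] := @products_nseq_prime P s MP.1.
  by case: MP => _; apply.
by exists k => // Q MQ; apply: sk; exact: products_Min s0 MQ.
Qed.

(** The element [k] is nonzero, being outside [P], and is killed by all [m]-fold products from [P];
    hence some nonzero multiple of it is killed by [P]. *)
Lemma Ann_Min P : Min R P -> Ann P <> zero_ideal.
Proof.
move=> MP; have [s sp s0] := zero_products.
have [Q /sp[]//|Q /sp Qp|k [m [nPk _ km]]] := @products_nseq_prime P s MP.1.
  by case: MP => _; apply.
have [k0|z /km/s0//|Q|r [rk rP]] := @products_nilpotent P (nseq m P) k.
- by apply: nPk; rewrite k0; case: MP => -[[]].
- by rewrite mem_nseq => /andP[_ /eqP->].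
by apply/(ideal_neq0 (ideal_Ann _)); exists (r * k).
Qed.

(** * Essential annihilators *)

Lemma essential_Ann_nil L :
  (1 : R) <> 0 -> L `<=` nilradical R -> essential (Ann L).
Proof.
move=> R1 Lnil; have [s sp s0] := zero_products.
(* A nil [L] lies in every prime of [s], so any nonzero element of [K] has a nonzero multiple killed
   by [L]. *)
have ex K : ideal K -> K <> zero_ideal -> exists x, [/\ x <> 0, K x & Ann L x].
  move=> Ki /(ideal_neq0 Ki)[x Kx x0].
  have [//|z /s0->|Q /sp Qp|r [rx0 rxL]] := @products_nilpotent L s x.
  - by rewrite mulr0.
  - by apply: subset_trans (nilradical_sub_prime Qp).
  by exists (r * x); split=> //; have [_ _] := Ki; apply.
split; first exact: ideal_Ann.
(* Taking the whole ring for [K] shows that [Ann L] is nonzero. *)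
- have [//||x [x0 _ Lx]] := ex setT.
    by move=> T0; apply: R1; have : [set: R] 1 by []; rewrite T0.
  by apply/(ideal_neq0 (ideal_Ann _)); exists x.
- move=> K Ki /(ex K Ki)[x [x0 Kx Lx]] E.
  by apply: x0; have : (Ann L `&` K) x by []; rewrite E.
Qed.

(* If x^n has maximal annihilator among the powers of x, then Ann x meets the
   ideal generated by x^n trivially. *)
Lemma nil_essential_Ann L : essential (Ann L) -> L `<=` nilradical R.
Proof.
move=> [_ _ ess] x Lx.
have [n|n r /= rx|N Nmax] := @noetherian_chain (fun n => Ann [set x ^+ n]).
- exact: ideal_Ann.
- by move=> _ ->; rewrite exprSr mulrA rx ?mul0r.
exists N; apply: contrapT => xN.
apply: (ess _ (ideal_principal (x ^+ N))).
  apply/(ideal_neq0 (ideal_principal _)); exists (x ^+ N) => //.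
  by exists 1; rewrite mul1r.
apply/seteqP; split=> [y [yL [r yr]]|_ ->]; last first.
  by split; [have [] := ideal_Ann L|exists 0; rewrite mul0r].
(* As [y * x = 0], the coefficient [r] kills [x ^+ N.+1], hence already [x ^+ N]. *)
rewrite /zero_ideal /= {1}yr; apply: (Nmax N.+1) => // _ ->.
by rewrite exprSr mulrA -yr; exact: yL.
Qed.

(** * Adjacency, cliques and colourings in [EG R] *)

Lemma EG_adjP I J : (1 : R) <> 0 ->
  EG_adj I J <-> I <> J /\ forall x y, I x -> J y -> nilradical R (x * y).
Proof.
move=> R1; split=> -[IJ h]; split=> //.
  move=> x y Ix Jy; apply: (nil_essential_Ann h).
  by exists 1%N, (fun=> x), (fun=> y); split=> //; rewrite big_ord1.
apply: essential_Ann_nil => // _ [n [a [b [Ia Jb ->]]]].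
apply/nilradicalP => P MP; have [[[P0 PD _] _ _] _] := MP.
by apply: big_ind => // i _; move/nilradicalP: (h _ _ (Ia i) (Jb i)); apply.
Qed.

Lemma nilradicalMl x y : nilradical R x -> nilradical R (x * y).
Proof. by move=> [n xn]; exists n; rewrite exprMn xn mul0r. Qed.

Lemma EG_clique (B : set (set R)) : (1 : R) <> 0 ->
  B `<=` annihilating_idealsS R ->
  (forall I J, B I -> B J -> I <> J ->
    forall x y, I x -> J y -> nilradical R (x * y)) ->
  clique (EG R) (nil_annihilating_idealsS R `|` B).
Proof.
move=> R1 BV Bnil; split=> [I [[]//|/BV//]|I J AI AJ IJ].
apply/EG_adjP => //; split=> // x y Ix Jy.
case: AI AJ => [[_ In] _|BI [[_ Jn]|BJ]]; first exact/nilradicalMl/In.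
- by rewrite mulrC; exact/nilradicalMl/Jn.
- exact: Bnil BI BJ _ _ _ _ _.
Qed.

(** A non-nil vertex is coloured by a minimal prime [f I] not containing it. If [I] and [J] share
    this prime, some [x * y] lies outside it and is not nilpotent, so they are not adjacent. *)
Lemma EG_colorable : (1 : R) <> 0 -> finite_set (nil_annihilating_idealsS R) ->
  colorable (EG R)
    (#|` fset_set (Min R)| + #|` fset_set (nil_annihilating_idealsS R)|)%N.
Proof.
move=> R1; set A := nil_annihilating_idealsS R => fA.
have /choice[f fP] (I : set R) : exists P, ~ (I `<=` nilradical R) ->
    Min R P /\ ~ (I `<=` P).
  have [In|nIn] := pselect (I `<=` nilradical R); first by exists I.
  apply: contrapT => nP; apply: nIn => x Ix; apply/nilradicalP => P MP.
  apply: contrapT => nPx; apply: nP; exists P => _; split=> // IP.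
  exact/nPx/IP.
pose iA I := index I (fset_set A); pose iM I := index (f I) (fset_set (Min R)).
have VA I : annihilating_idealsS R I -> ~ A I -> ~ (I `<=` nilradical R).
  by move=> VI nAI In; apply: nAI.
have iM_lt I : annihilating_idealsS R I -> ~ A I -> (iM I < #|` fset_set (Min R)|)%N.
  move=> VI nAI; rewrite index_mem in_fset_set ?inE; last exact: finite_Min.
  by have [] := fP I (VA I VI nAI).
have iA_lt I : A I -> (iA I < #|` fset_set A|)%N.
  by move=> AI; rewrite index_mem in_fset_set ?inE.
(* Each nil ideal gets a colour of its own, shifted past those reserved for minimal primes. *)
exists (fun I => if `[< A I >] then (#|` fset_set (Min R)| + iA I)%N else iM I).
split=> [I VI|I J VI VJ /(EG_adjP _ _ R1)[IJ nIJ]].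
  case: asboolP => [/iA_lt|/(iM_lt I VI) lt]; first by rewrite ltn_add2l.
  exact: leq_trans lt (leq_addr _ _).
case: asboolP => [AI|nAI]; case: asboolP => [AJ|nAJ].
- move=> /addnI /(index_inj I) eIJ; apply/IJ/eIJ; rewrite ?in_fset_set ?inE //.
- by have := iM_lt J VJ nAJ => + E; rewrite -E ltnNge leq_addr.
- by have := iM_lt I VI nAI => + E; rewrite E ltnNge leq_addr.
have [MI nI] := fP I (VA I VI nAI); have [MJ nJ] := fP J (VA J VJ nAJ).
move=> /(index_inj (f I)) fIJ.
have {}fIJ : f I = f J by apply: fIJ; rewrite in_fset_set ?inE //; exact: finite_Min.
have /existsNP[x /not_implyP[Ix nx]] := nI.
have /existsNP[y /not_implyP[Jy ny]] := nJ.
move: (nIJ x y Ix Jy) => /nilradicalP/(_ _ MI).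
have [[_ _ prI] _] := MI; case/prI => //; by rewrite fIJ.
Qed.

(** Common to both cases: [B] is the non-nil part of a largest clique. A colouring is demanded only
    for finitely many nil ideals, since otherwise the clique is infinite. *)
Lemma EG_numbers (B : set (set R)) n : (1 : R) <> 0 ->
  B `<=` annihilating_idealsS R ->
  (forall I, B I -> ~ (I `<=` nilradical R)) ->
  (forall I J, B I -> B J -> I <> J ->
    forall x y, I x -> J y -> nilradical R (x * y)) ->
  ecard B = Fin n ->
  (finite_set (nil_annihilating_idealsS R) ->
    colorable (EG R) (n + #|` fset_set (nil_annihilating_idealsS R)|)%N) ->
  clique_number (EG R) = (Fin n + ecard (nil_annihilating_idealsS R))%enat /\
  chromatic_number (EG R) = (Fin n + ecard (nil_annihilating_idealsS R))%enat.
Proof.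
move=> R1 BV BN Bnil Bn col; have cl := EG_clique R1 BV Bnil.
have dis I : nil_annihilating_idealsS R I -> ~ B I by move=> [_ In] /BN.
have cardAB := ecard_setU dis; rewrite Bn in cardAB.
have [fA|iA] := pselect (finite_set (nil_annihilating_idealsS R)).
  rewrite (ecard_finite fA) /= addnC in cardAB; rewrite (ecard_finite fA) /=.
  exact: colorable_clique_eq cl cardAB (col fA).
rewrite (ecard_infinite iA) in cardAB; rewrite (ecard_infinite iA).
exact: clique_infinite cl cardAB.
Qed.

Lemma EG_numbers_Min2 : (Fin 2 <= ecard (Min R))%enat ->
  clique_number (EG R) = (ecard (Min R) + ecard (nil_annihilating_idealsS R))%enat /\
  chromatic_number (EG R) = (ecard (Min R) + ecard (nil_annihilating_idealsS R))%enat.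
Proof.
move=> M2; have other P : exists2 Q, Min R Q & Q <> P.
  apply: contrapT => nQ; have /ecard_subset : Min R `<=` [set P].
    by move=> Q MQ; apply: contrapT => QP; apply: nQ; exists Q.
  by rewrite ecard_set1; move: M2; case: ecard => // n /= /leq_trans h /h.
(* The argument [set0] is a dummy: any minimal prime shows that the ring is nonzero. *)
have [P0 [P0p _] _] := other set0; have R1 := prime_one_neq0 P0p.
pose co P := [set x | forall Q, Min R Q -> Q <> P -> Q x].
have nco P : Min R P -> ~ (co P `<=` P).
  by move=> /Min_avoid[k nPk kQ] /(_ k kQ).
have co_ideal P : ideal (co P).
  split=> [Q [[[]]]//|x y cx cy Q MQ QP|a x cx Q MQ QP];
    have [[[_ QD QM] _ _] _] := MQ.
  - by apply: QD; [exact: cx|exact: cy].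
  - by apply: QM; exact: cx.
have coB : ecard (co @` Min R) = ecard (Min R).
  (* For [Q] distinct from [P], [co Q] lies in [P] whereas [co P] does not. *)
  apply: ecard_image_inj => P Q MP MQ PQ; apply: contrapT => nPQ.
  by apply: (nco P MP); rewrite PQ => x; apply.
rewrite (ecard_finite finite_Min); apply: (@EG_numbers (co @` Min R)) => //.
(* Since [co P] lies in another minimal prime [Q], whatever kills [Q] kills it. *)
- move=> _ [P MP <-]; have [Q MQ QP] := other P; split; last first.
    move=> /= c0; apply: (nco P MP); rewrite c0 => _ ->.
    by case: MP => -[[]].
  split=> //; have /(ideal_neq0 (ideal_Ann _))[y yQ y0] := Ann_Min MQ.
  apply/(ideal_neq0 (ideal_Ann _)); exists y => // x cx.
  by apply: yQ; exact: cx.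
- move=> _ [P MP <-] cn; apply: (nco P MP) => x /cn /nilradicalP; exact.
- move=> _ _ [P MP <-] [Q MQ <-] PQ x y cx cy; apply/nilradicalP => P' MP'.
  have [[[_ _ P'M] _ _] _] := MP'.
  have [P'P|nP'P] := pselect (P' = P); last by rewrite mulrC; apply: P'M; exact: cx.
  by apply: P'M; apply: cy => // P'Q; apply: PQ; rewrite -P'P P'Q.
- by rewrite coB ecard_finite //; exact: finite_Min.
- exact: EG_colorable.
Qed.

(** Here [n] is 1 if some vertex is not nil, and that vertex alone serves as [B]; otherwise [n] is 0
    and [B] is empty. *)
Lemma EG_numbers_Min1 : ecard (Min R) = Fin 1 ->
  exists2 n, (n <= 1)%N &
  clique_number (EG R) = (Fin n + ecard (nil_annihilating_idealsS R))%enat /\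
  chromatic_number (EG R) = (Fin n + ecard (nil_annihilating_idealsS R))%enat.
Proof.
move=> M1; have R1 : (1 : R) <> 0.
  have [[P [Pp _]]|noP] := pselect (exists P, Min R P); first exact: prime_one_neq0 Pp.
  have M0 : Min R = set0 by rewrite -subset0 => P MP; case: noP; exists P.
  by move: M1; rewrite M0 ecard_finite // fset_set0 cardfs0.
have [[I VI nI]|allA] := pselect
    (exists2 I, annihilating_idealsS R I & ~ (I `<=` nilradical R)).
  exists 1%N => //; apply: (@EG_numbers [set I]) => //.
  - by move=> _ ->.
  - by move=> _ ->.
  - by move=> _ _ -> ->.
  - exact: ecard_set1.
  - move=> fA; have := EG_colorable R1 fA.
    by move: M1; rewrite (ecard_finite finite_Min) => -[->].
have VA I : annihilating_idealsS R I -> nil_annihilating_idealsS R I.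
  by move=> VI; split=> //; apply: contrapT => nI; apply: allA; exists I.
exists 0%N => //; apply: (@EG_numbers set0) => //.
  by rewrite ecard_finite // fset_set0 cardfs0.
(* All vertices are nil, so the colour reserved for the minimal prime can be saved. *)
move=> fA; exists (fun I => index I (fset_set (nil_annihilating_idealsS R))).
split=> [I /VA AI|I J /VA AI /VA AJ [IJ _] /(index_inj I) eIJ].
  by rewrite add0n index_mem in_fset_set ?inE.
by apply/IJ/eIJ; rewrite in_fset_set ?inE.
Qed.

End Ideals.

Theorem theorem2p1 (R : comPzRingType) (noethR : noetherian R) :
  ((Fin 2 <= ecard (Min R))%enat ->
     clique_number (EG R) = chromatic_number (EG R) /\
     chromatic_number (EG R) =
       (ecard (Min R) + ecard (nil_annihilating_idealsS R))%enat) /\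
  (ecard (Min R) = Fin 1 ->
     (ecard (nil_annihilating_idealsS R) <= clique_number (EG R))%enat /\
     clique_number (EG R) = chromatic_number (EG R) /\
     (chromatic_number (EG R) <=
       ecard (nil_annihilating_idealsS R) + Fin 1)%enat).
Proof.
split=> [/(EG_numbers_Min2 noethR)[-> ->]//|].
move=> /(EG_numbers_Min1 noethR)[n n1 [-> ->]].
case: ecard => [a|] //=; split; first exact: leq_addl.
by split=> //; rewrite addnC leq_add2l.
Qed.
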